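(* Let $f:\mathbb{R}^n\to\mathbb{R}^n$ be a smooth vector field and fix generating functions of its components. Suppose the generating functions are generic. Let $\mathcal{G}$ be an admissible graph for $f$ obtained in Step 3 of the realization procedure, with $n$ cells, and let $\gamma:\mathcal{C}\to\mathcal{C}$ be a bijection that preserves the input classes of $\mathcal{G}$. If $\gamma\mathcal{G}$ is an admissible graph for $f$, then there exists $\gamma'=(\gamma_{\mathcal{C}},\gamma_{\mathcal{E}})\in\mathrm{Aut}(\bar{\mathcal{G}})$ such that $\gamma=\gamma_{\mathcal{C}}$.
   Context: Network graphs. A network graph $\mathcal{G}=(\mathcal{C},\mathcal{E},\sim_{\mathcal{C}},\sim_{\mathcal{E}})$ consists of finite sets of cells $\mathcal{C}$ and arrows $\mathcal{E}$ with equivalence relations and head and tail maps $\mathcal{H},\mathcal{T}:\mathcal{E}\to\mathcal{C}$, equivalent arrows having $\sim_{\mathcal{C}}$-equivalent heads and tails. $I(c)=\mathcal{H}^{-1}(c)$ is the input set of $c$. Loops and multiple arrows are allowed. Setting. $\mathcal{C}=\{1,\dots,n\}$, each cell phase space is $\mathbb{R}$. Step 1. For each cell $c$ a generating function $\hat f_c$ with real variables $y$ and $(y_e)_{e\in I(c)}$ is fixed such that $\partial\hat f_c/\partial y_e\not\equiv0$ for every $e\in I(c)$ and $f_c(x)=\hat f_c(x_c,(x_{\mathcal{T}(e)})_{e\in I(c)})$ for all $x$. (The number of arrows from $d$ to $c$ is the number of variables of $\hat f_c$ into which $x_d$ is substituted, apart from the first variable.) A relation $\sim_{\mathcal{C}}$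 on cells is also fixed. Step 2. $I(c)$ is uniquely partitioned into parts $K^1(c),\dots,K^r(c)$ such that $\hat f_c$ is invariant under all permutations of the variables in each part, the tails of the arrows in each part lie in one $\sim_{\mathcal{C}}$-class, and the parts are maximal with these properties. Step 3. For $c\sim_{\mathcal{C}}d$, $c\sim_Id$ iff the parts of $I(c)$ and of $I(d)$ can be indexed with $|K^i(c)|=|K^i(d)|$, $i=1,\dots,r$, so that $\hat f_c$ and $\hat f_d$ are the same function when the variables of the $i$-th parts are identified for each $i$. The classes $Q$ of $\sim_I$ are the input classes; the common function is denoted $g_Q$. Choose mutually consistent indexings for all $c\in Q$. The arrows in $\bigcup_{c\in Q}K^i(c)$ form one edge class of $\mathcal{G}$, called the $i$-th edge class of $Q$, for each $Q$ and $i$. The collection of indices $\{1,\dots,r\}$ for $Q$ is partitioned into maximal groups $J_1,\dots,J_v$ such that $g_Q$ is invariant under all permutations, as whole blocks, of the sets of variables of the parts with index in the same group (so parts in the same group have the same size). Definition of $\bar{\mathcal{G}}$. $\bar{\mathcal{G}}$ has the same cells, arrows, heads, tails and $\sim_{\mathcal{C}}$ as $\mathcal{G}$, and its edge classes are the unions, over $i$ in a group, of the $i$-th edge classes of $Q$: one edge class for each input class $Q$ and each group $J_t$ of $Q$. Definition of $\mathrm{Aut}(\bar{\mathcal{G}})$. It is the group of pairs of bijections $\gamma_{\mathcal{C}}:\mathcal{C}\to\mathcal{C}$, $\gamma_{\mathcal{E}}:\mathcal{E}\to\mathcal{E}$ with $\mathcal{H}(\gamma_{\mathcal{E}}(e))=\gamma_{\mathcal{C}}(\mathcal{H}(e))$,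 $\mathcal{T}(\gamma_{\mathcal{E}}(e))=\gamma_{\mathcal{C}}(\mathcal{T}(e))$, preserving cell types and each edge class of $\bar{\mathcal{G}}$ (so $\gamma_{\mathcal{E}}(e)$ and $e$ are in the same edge class of $\bar{\mathcal{G}}$). Definition of $\gamma\mathcal{G}$. For a bijection $\gamma$ of $\mathcal{C}$ preserving the input classes ($\gamma(Q)=Q$ for each $Q$), $\gamma\mathcal{G}$ has the same arrows and edge classes as $\mathcal{G}$ but head map $\gamma\circ\mathcal{H}$ and tail map $\gamma\circ\mathcal{T}$; if $A^i$ is the adjacency matrix of an edge class of $\mathcal{G}$ ($(A^i)_{ab}$ = number of arrows of that class from $b$ to $a$), the corresponding adjacency matrix of $\gamma\mathcal{G}$ is $\gamma A^i\gamma^{-1}$. That $\gamma\mathcal{G}$ is an admissible graph for $f$ (with the fixed generating functions) means: for each input class $Q$ and $c\in Q$, $f_c(x)=g_Q(x_c,\dots)$, where the variables of the $i$-th block of $g_Q$ are the $x_d$ with $d$ running over the tails in $\gamma\mathcal{G}$ of the arrows of the $i$-th edge class of $Q$ having head $c$ in $\gamma\mathcal{G}$, for every $i$. Generic generating functions. For $a\in\mathbb{R}$ let $\nu_a=(a,\dots,a)$. For each $Q$ and each group $J_t$ let $y_{(t)}$ be any variable of a part whose index is in $J_t$ (by symmetry $\partial g_Q/\partial y_{(t)}(\nu_a)$ does not depend on the choice). The generating functions are generic if for each $Q$ there exist $a_1,\dots,a_v\in\mathbb{R}$ such that $\det\bigl[\frac{\partial g_Q}{\partial y_{(t)}}(\nu_{a_s})\bigr]_{s,t=1}^{v}\neq0$.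 *)

(* Defs.v *)
From HB Require Import structures.
From mathcomp Require Import all_boot all_order all_fingroup all_algebra.
From mathcomp Require Import all_classical all_reals all_analysis.
Import Order.TTheory GRing.Theory Num.Theory.
Import numFieldNormedType.Exports.

Set Implicit Arguments.
Unset Strict Implicit.
Unset Printing Implicit Defensive.

Local Open Scope ring_scope.

(* Points of the real space whose coordinates are indexed by a finite set V are
   functions V -> R, with the product topology {ptws V -> R}. *)
Section Smoothness.
Variables (R : realType) (V : finType).

Definition partial (v : V) (F : (V -> R) -> R) (x : V -> R) : R :=
  derive1 (fun t : R => F (dfwith x v t)) (x v).

Definition iter_partial (s : seq V) (F : (V -> R) -> R) : (V -> R) -> R :=
  foldr partial F s.

(* Every iterated partial derivative exists and is jointly continuous. *)
Definition smooth (F : (V -> R) -> R) : Prop :=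
  forall s : seq V,
    continuous (iter_partial s F : {ptws V -> R} -> R) /\
    (forall (v : V) (x : V -> R),
        derivable (fun t : R => iter_partial s F (dfwith x v t)) (x v) 1).

End Smoothness.

(* The laws of a network graph are kept apart, in [is_network_graph]: the graph
   [coarsening] below need not satisfy the condition on tails. *)
Record network (C : finType) := Network {
  arrow : finType;
  arrow_head : arrow -> C;
  arrow_tail : arrow -> C;
  cell_eqv : rel C;
  arrow_eqv : rel arrow }.

Definition is_network_graph (C : finType) (G : network C) : Prop :=
  [/\ equivalence_rel (@cell_eqv C G),
      equivalence_rel (@arrow_eqv C G) &
      forall e e' : arrow G, arrow_eqv e e' ->
        cell_eqv G (arrow_head e) (arrow_head e') /\
        cell_eqv G (arrow_tail e) (arrow_tail e')].

Definition input (C : finType) (G : network C) (c : C) : finType :=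
  {e : arrow G | arrow_head e == c}.

Definition relabel (C : finType) (gamma : {perm C}) (G : network C) :
    network C :=
  @Network C (arrow G)
    (fun e => gamma (arrow_head e)) (fun e => gamma (arrow_tail e))
    (@cell_eqv C G) (@arrow_eqv C G).

(* The underlying set of the automorphism group. *)
Definition graph_aut (C : finType) (G : network C) :
    {set {perm C} * {perm arrow G}} :=
  [set g : {perm C} * {perm arrow G} |
    [&& [forall e : arrow G, arrow_head (g.2 e) == g.1 (arrow_head e)],
        [forall e : arrow G, arrow_tail (g.2 e) == g.1 (arrow_tail e)],
        [forall c : C, cell_eqv G c (g.1 c)] &
        [forall e : arrow G, arrow_eqv e (g.2 e)]]].

Definition maximal_partition (T : finType) (good : {set T} -> Prop)
    (P : {set {set T}}) : Prop :=
  finset.partition P [set: T]%SET /\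
  {in P, forall A, maxset (fun B : {set T} => `[< good B >]) A}.

Section Realization.
Variables (R : realType) (C : finType) (G : network C).

(* [fh c y0 y] has first variable y0 and one variable y e for each arrow e with
   head c. *)
Variable fh : forall c : C, R -> (input G c -> R) -> R.
Implicit Types (c d q : C) (r : nat).

Definition smooth_gen c : Prop :=
  smooth (fun z : option (input G c) -> R =>
            fh (z None) (fun e => z (Some e))).

Definition generating (f : (C -> R) -> (C -> R)) : Prop :=
  [/\ forall c, smooth_gen c,
      forall c (e : input G c), exists y0 y, partial e (fh y0) y != 0 &
      forall c x, f x c =
        fh (x c) (fun e : input G c => x (arrow_tail (val e)))].

Definition symmetric_on c (A : {set input G c}) : Prop :=
  forall s : {perm input G c}, perm_on A s ->
  forall y0 y, fh y0 (y \o s) = fh y0 y.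

Definition input_parts c (P : {set {set input G c}}) : Prop :=
  maximal_partition
    (fun A => symmetric_on A /\
       {in A &, forall e e',
          cell_eqv G (arrow_tail (val e)) (arrow_tail (val e'))}) P.

(* An indexing of the r parts of I(c) by 0, ..., r - 1 is encoded by the map
   sending an arrow to the index of its part. *)
Definition part c (i : input G c -> nat) (k : nat) : {set input G c} :=
  [set e | i e == k].

Definition indexing c r (i : input G c -> nat) : Prop :=
  input_parts [set part i k | k : 'I_r].

(* The identification of the variables inside a pair of parts is irrelevant, by
   symmetry; such a bijection b exists by the equality of cardinals. *)
Definition same_function c d (i : input G c -> nat) (j : input G d -> nat) :
    Prop :=
  (forall k : nat, #|part i k| = #|part j k|) /\
  (forall b : input G c -> input G d, bijective b ->
     (forall e, j (b e) = i e) ->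
     forall y0 y, fh y0 (y \o b) = fh y0 y).

Definition input_equiv c d : Prop :=
  cell_eqv G c d /\
  exists (r : nat) (i : input G c -> nat) (j : input G d -> nat),
    [/\ indexing r i, indexing r j & same_function i j].

Definition input_class c : {set C} := [set d | `[< input_equiv c d >]].

(* r c is the number of parts of I(c) and idx e is the index of the part of
   I(arrow_head e) which contains e. *)
Variables (r : C -> nat) (idx : arrow G -> nat).

Definition input_idx c (e : input G c) : nat := idx (val e).

Definition step3 : Prop :=
  [/\ forall c, indexing (r c) (@input_idx c),
      forall c d, input_equiv c d ->
        r c = r d /\ same_function (@input_idx c) (@input_idx d) &
      forall e e' : arrow G,
        arrow_eqv e e' <->
        input_equiv (arrow_head e) (arrow_head e') /\ idx e = idx e'].

(* From here on, the function g_Q of an input class Q is represented by fh c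
   for any c in Q. *)

(* s permutes the variables so as to carry the k-th block onto the p k-th. *)
Definition block_symmetric c (A : {set 'I_(r c)}) : Prop :=
  {in A &, forall k l : 'I_(r c),
     #|part (@input_idx c) k| = #|part (@input_idx c) l|} /\
  (forall p : {perm 'I_(r c)}, perm_on A p ->
   forall s : {perm input G c},
     (forall k : 'I_(r c),
        s @: part (@input_idx c) k = part (@input_idx c) (p k)) ->
   forall y0 y, fh y0 (y \o s) = fh y0 y).

Variable J : forall c : C, {set {set 'I_(r c)}}.

Definition index_groups : Prop :=
  forall c, maximal_partition (@block_symmetric c) (J c).

Definition index_in c (A : {set 'I_(r c)}) (i : nat) : bool :=
  [exists k in A, i == k :> nat].

Definition coarsening : network C :=
  @Network C (arrow G) (@arrow_head C G) (@arrow_tail C G) (@cell_eqv C G)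
    (fun e e' => `[< input_equiv (arrow_head e) (arrow_head e') /\
       exists2 A : {set 'I_(r (arrow_head e))}, A \in J (arrow_head e) &
         index_in A (idx e) /\ index_in A (idx e') >]).

Definition generic : Prop :=
  forall c (y : 'I_#|J c| -> input G c),
    (forall t, index_in (enum_val t : {set 'I_(r c)}) (input_idx (y t))) ->
  exists a : 'I_#|J c| -> R,
    \det (\matrix_(s, t) partial (y t) (fh (a s)) (fun=> a s)) != 0.

Definition preserves_input_classes (gamma : {perm C}) : Prop :=
  forall c, [set gamma d | d in input_class c]%SET = input_class c.

(* b fills the variables of the i-th block of g_Q, taken to be fh q, with the
   arrows of the i-th edge class of Q whose head is c in the relabelled graph. *)
Definition relabel_admissible (f : (C -> R) -> (C -> R)) (gamma : {perm C}) :
    Prop :=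
  forall q c, c \in input_class q ->
  exists b : input G q -> input (relabel gamma G) c,
    [/\ bijective b,
        forall e, @arrow_eqv C G (val e) (val (b e)) &
        forall x, f x c =
          fh (x c) (fun e : input G q =>
                      x (@arrow_tail C (relabel gamma G) (val (b e))))].

End Realization.

(* Main.v *)
Require Import Defs.
From mathcomp Require Import all_boot all_order all_fingroup all_algebra.
From mathcomp Require Import all_classical all_reals all_analysis.
Import Order.TTheory GRing.Theory Num.Theory.
Import numFieldNormedType.Exports.

(** Fix a cell [d] and put [c = gamma d]; since [gamma] preserves input
    classes, [c] and [d] have the same generating function [g = fh d].  Two
    formulas for the component [f_c] are then available: one fills the
    variables of [g] with the tails of the arrows into [c], the other, given
    by the admissibility of the relabelled graph, with the [gamma]-images of
    the tails of the arrows into [d].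

    Equate the two and differentiate with respect to [x_b] at the diagonal
    point [(a, ..., a)].  By the chain rule ([is_derive_diagonal]) each side
    becomes the sum of the partial derivatives of [g] in those variables into
    which [x_b] is substituted; the contribution of the first variable is the
    same on both sides and cancels ([eq_sum_partial_inputs]).  On the diagonal
    the partial derivative of [g] depends only on the group [J_t] of the
    variable ([partial_block]), so the identity reads
    [\sum_t N_t (d g / d y_t)(a) = \sum_t N'_t (d g / d y_t)(a)], where [N_t]
    counts the arrows of group [t] from [b] to [c], and [N'_t] those from
    [gamma^-1 b] to [d].  Genericity provides diagonal points at which the matrix
    of this linear system is invertible, hence [N_t = N'_t]
    ([eq_card_labels]).

    Equal counts give a bijection between the arrows into [d] and those into
    [gamma d] that carries tails by [gamma] and respects the groups
    ([match_moved_inputs]).  As every arrow has exactly one head, these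
    bijections, one for each [d], glue to the required permutation of the
    arrows ([glue]). *)

Set Implicit Arguments.
Unset Strict Implicit.
Unset Printing Implicit Defensive.

Local Open Scope ring_scope.

(** * The chain rule along the diagonal *)

Local Open Scope classical_set_scope.

(** Bounding [xi] through its distance to [a], instead of by an interval, makes
    one statement serve both signs of [t - a], and [t = a] as well. *)
Lemma mean_value_between (R : realType) (g : R -> R) (a t : R) :
  (forall x, derivable g x 1) ->
  exists2 xi, `|xi - a| <= `|t - a| & g t - g a = derive1 g xi * (t - a).
Proof.
move=> dg.
have mvt (u w : R) : u < w -> exists2 xi, xi \in `]u, w[%R &
    g w - g u = derive1 g xi * (w - u).
  move=> uw; apply: MVT => // [x _|].
    by rewrite derive1E; exact/derivableP.
  exact: derivable_within_continuous.
case: (ltgtP a t) => [at_|ta|->]; last first.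
- by exists t; rewrite // !subrr mulr0.
- have [xi /[!in_itv]/= /andP[txi xia] e] := mvt _ _ ta; exists xi.
    rewrite distrC (distrC t) !ger0_norm ?subr_ge0 ?ltW //.
    by rewrite ltrD2l ltrN2.
  by rewrite -opprB e -mulrN opprB.
- have [xi /[!in_itv]/= /andP[axi xit] e] := mvt _ _ at_; exists xi => //.
  rewrite !ger0_norm ?subr_ge0 ?ltW //.
  by rewrite ltrD2r.
Qed.

(** The product topology is the coarsest one making the projections
    continuous, so its convergence is tested on coordinates. *)
Lemma cvg_coordinatewise (R : realType) (V : finType) (T : Type)
    (F : set_system T) (FF : Filter F) (z : T -> V -> R) (x : V -> R) :
  (forall v, z t v @[t --> F] --> x v) ->
  z t @[t --> F] --> (x : {ptws V -> R}).
Proof.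
move=> zx; apply/cvg_sup => v U.
move=> [_ [[C oC <-] Cx] CU]; apply: filterS CU _; apply: zx.
exact: open_nbhs_nbhs.
Qed.

Section ChainRule.
Variables (R : realType) (V : finType) (F : (V -> R) -> R).
Hypothesis smoothF : smooth F.

Lemma dfwith_dfwith (x : V -> R) v (s t : R) :
  dfwith (dfwith x v s) v t = dfwith x v t.
Proof.
apply/funext => w; have [<-|vw] := eqVneq v w; first by rewrite !dfwithin.
by rewrite !dfwithout.
Qed.

Lemma dfwith_id (x : V -> R) v : dfwith x v (x v) = x.
Proof.
by apply/funext => w; have [<-|vw] := eqVneq v w; rewrite ?dfwithin ?dfwithout.
Qed.

Lemma partial_line v (x : V -> R) (t : R) :
  derive1 (fun u => F (dfwith x v u)) t = partial v F (dfwith x v t).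
Proof.
rewrite /partial dfwithin; congr (derive1 _ t).
by apply/funext => u; rewrite dfwith_dfwith.
Qed.

Lemma derivable_line v (x : V -> R) (t : R) :
  derivable (fun u => F (dfwith x v u)) t 1.
Proof.
have [_ /(_ v (dfwith x v t))] := smoothF [::].
rewrite dfwithin /=; congr (derivable _ t 1).
by apply/funext => u; rewrite dfwith_dfwith.
Qed.

(** Adding one moving coordinate at a time reduces the chain rule to a single
    variable [v]: the mean value theorem writes the increment due to [v] as
    [t - a] times a partial derivative at a point which tends to the diagonal
    point, where the joint continuity of that derivative concludes. *)
Lemma is_derive_diagonal (a : R) (s : seq V) : uniq s ->
  is_derive a 1 (fun t => F (fun v => if v \in s then t else a))
    (\sum_(v <- s) partial v F (fun=> a)).
Proof.
elim: s => [_|v s IH /= /andP[vs us]].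
  by rewrite big_nil; exact: (is_derive_cst (F (fun=> a))).
rewrite big_cons.
pose w t : V -> R := fun u => if u \in s then t else a.
(* D is the increment due to v while the coordinates in s already moved. *)
pose D t := F (dfwith (w t) v t) - F (w t).
have wv t : w t v = a by rewrite /w (negbTE vs).
have -> : (fun t => F (fun u => if u \in v :: s then t else a)) =
    D + (fun t => F (w t)).
  apply/funext => t; rewrite /D /GRing.add /= subrK; congr F.
  apply/funext => u; rewrite inE; have [<-|vu] := eqVneq v u.
    by rewrite dfwithin.
  by rewrite dfwithout.
apply: is_deriveD; last exact: IH.
have /boolp.choice[xi xiP] : forall t, exists x,
    `|x - a| <= `|t - a| /\ D t = partial v F (dfwith (w t) v x) * (t - a).
  move=> t.
  have [x xt e] := mean_value_between a t (@derivable_line v (w t)).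
  exists x; split=> //; rewrite -partial_line -e /D.
  by rewrite -(wv t) dfwith_id.
have Da : D a = 0 by have [_ ->] := xiP a; rewrite subrr mulr0.
have Dcvg : h^-1 *: ((D \o shift a) (h *: (1 : R)) - D a) @[h --> 0^']
    --> partial v F (fun=> a).
  have [/(_ (fun=> a)) /= cF _] := smoothF [:: v].
  (* Every coordinate of the intermediate point stays within |h| of a. *)
  have to_a (u : R -> R) : (forall h, `|u h - a| <= `|h|) ->
      u h @[h --> 0^'] --> a.
    move=> ua; apply/cvgrPdist_le => e e0; near=> h.
    rewrite distrC (le_trans (ua h))//.
    by near: h; exact: dnbhs0_le.
  have zcvg : dfwith (w (h + a)) v (xi (h + a)) @[h --> 0^'] -->
      ((fun=> a) : {ptws V -> R}).
    apply: cvg_coordinatewise => u; apply: to_a => h.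
    have [<-|vu] := eqVneq v u.
      by rewrite dfwithin (le_trans (xiP _).1)// addrK.
    rewrite dfwithout // /w; case: ifP => _; first by rewrite addrK.
    by rewrite subrr normr0.
  have := cvg_comp _ _ zcvg cF; apply: cvg_trans; apply: near_eq_cvg.
  near=> h; rewrite /= Da subr0 [h *: 1]mulr1 (xiP _).2 addrK.
  rewrite [_ *: _]mulrC mulfK //.
  by near: h; exact: nbhs_dnbhs_neq.
split; first by apply/cvg_ex; eexists; exact: Dcvg.
exact: (cvg_lim _ Dcvg).
Unshelve. all: by end_near. Qed.

Lemma eq_sum_partial (a : R) (P Q : pred V) :
  (forall t, F (fun v => if P v then t else a) =
             F (fun v => if Q v then t else a)) ->
  \sum_(v | P v) partial v F (fun=> a) = \sum_(v | Q v) partial v F (fun=> a).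
Proof.
move=> PQ.
have enumE (A : pred V) : (fun t => F (fun v => if A v then t else a)) =
    (fun t => F (fun v => if v \in enum A then t else a)).
  by apply/funext => t; congr F; apply/funext => v; rewrite mem_enum.
have dF (A : pred V) :
    is_derive a 1 (fun t => F (fun v => if A v then t else a))
      (\sum_(v | A v) partial v F (fun=> a)).
  by rewrite enumE -big_enum; apply: is_derive_diagonal; exact: enum_uniq.
rewrite -(@derive_val _ _ _ _ _ _ _ (dF P)) -(@derive_val _ _ _ _ _ _ _ (dF Q)).
by congr ('D_1 _ a); exact/funext.
Qed.
End ChainRule.
Local Close Scope classical_set_scope.

(** * Counting *)

(** Inside each fiber the [n]-th point goes to the [n]-th point, in the
    order of the enumerations. *)
Lemma eq_card_fibers_bij (S T : finType) (K : eqType)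
    (u : S -> K) (v : T -> K) :
  (forall k, #|[pred x | u x == k]| = #|[pred y | v y == k]|) ->
  exists2 h : S -> T, bijective h & forall x, v (h x) = u x.
Proof.
have half (S' T' : finType) (u' : S' -> K) (v' : T' -> K) :
    (forall k, #|[pred x | u' x == k]| = #|[pred y | v' y == k]|) ->
    exists2 h : S' -> T', injective h & forall x, v' (h x) = u' x.
  move=> uv.
  pose fib x := enum [pred y | v' y == u' x].
  pose pos x := index x (enum [pred z | u' z == u' x]).
  have pos_lt x : (pos x < size (fib x))%N.
    by rewrite -cardE -uv cardE index_mem mem_enum inE.
  (* The default value of nth has to be found before T' is known to be
     inhabited: any entry of the nonempty fiber serves. *)
  have Ex x : {y | y = nth y (fib x) (pos x)}.
    have : fib x != [::].
      by rewrite -size_eq0 -lt0n (leq_ltn_trans _ (pos_lt x)).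
    case E : (fib x) => [//|y s] _; exists (nth y (y :: s) (pos x)).
    by apply: set_nth_default; rewrite -E.
  pose h x := sval (Ex x).
  have hE x y : h x = nth y (fib x) (pos x).
    by rewrite (set_nth_default (h x)) //; exact: (svalP (Ex x)).
  have vh x : v' (h x) = u' x.
    have : h x \in fib x by rewrite (hE x (h x)) mem_nth.
    by rewrite /fib mem_enum inE => /eqP.
  exists h => // x y exy.
  have uxy : u' x = u' y by rewrite -!vh exy.
  have fxy : fib x = fib y by rewrite /fib uxy.
  move: exy; rewrite (hE x (h x)) (hE y (h x)) -fxy => /eqP.
  rewrite nth_uniq ?enum_uniq ?pos_lt // 1?fxy ?pos_lt //.
  rewrite /pos uxy => /eqP pxy.
  have mem_fib z : u' z = u' y -> z \in enum [pred z | u' z == u' y].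
    by move=> uz; rewrite mem_enum inE uz.
  by rewrite -(nth_index x (mem_fib x uxy)) pxy nth_index ?mem_fib.
move=> uv; have [h hI hE] := half _ _ _ _ uv.
have [g gI _] := half _ _ _ _ (fun k => esym (uv k)).
by exists h => //; apply: inj_card_bij hI (leq_card g gI).
Qed.

(** Grouping each sum by label turns the hypothesis into an equality of
    matrix-vector products [M N = M N'], [N] and [N'] being the vectors of label
    counts; [M] is invertible, and naturals embed in a field of
    characteristic 0. *)
Lemma eq_card_labels (F : numFieldType) (I : finType) (m : nat)
    (tau : I -> 'I_m) (M : 'M[F]_m) (P Q : pred I) :
  \det M != 0 ->
  (forall s, \sum_(e | P e) M s (tau e) = \sum_(e | Q e) M s (tau e)) ->
  forall t, #|[pred e | P e && (tau e == t)]| =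
            #|[pred e | Q e && (tau e == t)]|.
Proof.
move=> detM PQ.
pose N (A : pred I) : 'cV[F]_m := \col_t #|[pred e | A e && (tau e == t)]|%:R.
have MN (A : pred I) s : (M *m N A) s 0 = \sum_(e | A e) M s (tau e).
  rewrite mxE (partition_big tau predT) //=; apply: eq_bigr => t _.
  rewrite (eq_bigr (fun=> M s t)) => [|e /andP[_ /eqP->] //].
  by rewrite sumr_const mxE mulr_natr.
have eqN : N P = N Q.
  apply: (can_inj (mulKmx _)); first by rewrite unitmxE unitfE; exact: detM.
  by apply/colP => s; rewrite !MN PQ.
move=> t; apply/eqP; rewrite -(eqr_nat F); apply/eqP.
by have := congr1 (fun B : 'cV_m => B t 0) eqN; rewrite !mxE.
Qed.

Lemma big_option (W : nmodType) (I : finType) (P : pred (option I))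
    (g : option I -> W) :
  \sum_(v | P v) g v =
  (if P None then g None else 0) + \sum_(e | P (Some e)) g (Some e).
Proof.
rewrite (bigID (fun v => v == None)) /=; congr (_ + _).
  case: ifP => PN.
    rewrite (big_pred1 None) // => v; rewrite inE.
    by case: eqP => [->|]; rewrite ?PN ?andbF.
  by rewrite big1 // => v /andP[Pv /eqP vN]; rewrite -vN Pv in PN.
rewrite (reindex_omap Some id); last by case=> // /andP[_ /eqP].
by apply: eq_bigl => e; rewrite /= andbT eqxx andbT.
Qed.

(** * Symmetries of the generating functions *)

Lemma maximal_partition_good (T : finType) (good : {set T} -> Prop)
    (P : {set {set T}}) (A : {set T}) :
  maximal_partition good P -> A \in P -> good A.
Proof. by move=> [_ maxP] /maxP/maxsetP[/asboolP]. Qed.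

Section Network.
Variables (R : realType) (C : finType) (G : network C).
Variable fh : forall c : C, R -> (input G c -> R) -> R.
Implicit Types c d : C.

Section Indexing.
Variables (c : C) (n : nat) (i : input G c -> nat).
Hypothesis ind : indexing fh n i.

Lemma index_lt (e : input G c) : (i e < n)%N.
Proof.
have [/and3P[/eqP cov _ _] _] := ind.
have : e \in finset.cover [set part i k | k : 'I_n]%SET by rewrite cov inE.
by move=> /bigcupP[B /imsetP[k _ ->]]; rewrite inE => /eqP ->; exact: ltn_ord.
Qed.

Lemma index_surj (k : 'I_n) : exists e, i e = k.
Proof.
have [/and3P[_ _ n0] _] := ind.
have [pk0|[e]] := set_0Vmem (part i k).
  by move: n0; rewrite -pk0 imset_f.
by rewrite inE => /eqP; exists e.
Qed.

(** Invariance is given within one part at a time.  A permutation that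
    preserves every part is a product of transpositions inside parts: composing
    it with the transposition of [s e] and [e] fixes [e] and moves fewer
    points. *)
Lemma perm_index_invariant (s : {perm input G c}) :
  (forall e, i (s e) = i e) -> forall y0 y, fh y0 (y \o s) = fh y0 y.
Proof.
have [m] := ubnP #|[set e | s e != e]%SET|.
elim: m s => // m IH s /[!ltnS] sm si y0 y.
have [s0|[e /[!inE] se]] := set_0Vmem [set e | s e != e]%SET.
  congr (fh _ _); apply/funext => e; congr (y _); apply/eqP.
  by have := finset.in_set0 e; rewrite -s0 inE => /negbFE.
pose t := tperm (s e) e.
have ti x : i (t x) = i x by rewrite /t; case: tpermP => // ->.
have -> : y \o s = (y \o t) \o (s * t)%g.
  by apply/funext => x /=; rewrite permM tpermK.
rewrite IH; last 2 first.
- apply: leq_trans sm; apply: proper_card; apply/fintype.properP; split.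
    apply/fintype.subsetP => x; rewrite !inE permM; apply: contraNneq => sx.
    rewrite sx tpermD //; last by apply: contraNneq se => ->; apply/eqP.
    by apply: contraNneq se => sex; apply/eqP/(@perm_inj _ s); rewrite sex.
  by exists e; rewrite !inE ?permM ?tpermL ?eqxx.
- by move=> x; rewrite permM ti.
have eP : part i (i e) \in [set part i k | k : 'I_n]%SET.
  by apply/imsetP; exists (Ordinal (index_lt e)).
have [sym _] := maximal_partition_good ind eP.
apply: sym; apply/fintype.subsetP => x; rewrite !inE; apply: contraNT => ix.
rewrite tpermD //; apply: contraNneq ix => <-//; exact/eqP.
Qed.

(** Reflexivity of the input equivalence is not immediate from its definition:
    it contains the invariance of [fh c] under all part-preserving
    bijections. *)
Lemma same_function_refl : same_function fh i i.
Proof.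
split=> // b bb bi y0 y.
have -> : y \o b = y \o perm (bij_inj bb).
  by apply/funext => e; rewrite /= permE.
by apply: perm_index_invariant => e; rewrite permE bi.
Qed.

End Indexing.

Section Block.
Variables (r : C -> nat) (idx : arrow G -> nat).
Variables (d : C) (A : {set 'I_(r d)}).
Hypotheses (ind : indexing fh (r d) (input_idx idx (c := d))).
Hypothesis (symA : block_symmetric fh idx A).

Lemma index_inP (k : nat) :
  reflect (exists2 l, l \in A & k = l :> nat) (index_in A k).
Proof.
apply: (iffP existsP) => [[l /andP[lA /eqP ->]]|[l lA ->]]; exists l => //.
by rewrite lA eqxx.
Qed.

(** On the diagonal the derivative depends only on the group of the variable:
    exchanging the two blocks of [e] and [e'] can be done so that [e] goes to
    [e'], and the constant point is unchanged by permuting variables. *)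
Lemma partial_block (e e' : input G d) (a0 a : R) :
  index_in A (input_idx idx e) -> index_in A (input_idx idx e') ->
  partial e (fh a0) (fun=> a) = partial e' (fh a0) (fun=> a).
Proof.
move=> /index_inP[k kA ek] /index_inP[l lA e'l].
have [sizeA invA] := symA.
pose u x := Ordinal (index_lt ind x); pose p := tperm k l.
have partE m : part (input_idx idx (c := d)) (m : 'I_(r d)) =
    [set x | u x == m]%SET.
  by apply/setP => x; rewrite !inE.
have pA : perm_on A p.
  apply/fintype.subsetP => x; rewrite !inE; apply: contraNT => xA.
  by rewrite tpermD //; apply: contraNneq xA => <-.
have size_p (m : 'I_(r d)) : #|part (input_idx idx (c := d)) m| =
    #|part (input_idx idx (c := d)) (p m)|.
  by rewrite /p; case: tpermP => [->|->|] //; exact: sizeA.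
have [s bs sE] : exists2 s, bijective s & forall x, u (s x) = p (u x).
  apply: eq_card_fibers_bij => m.
  have pK : involutive p := tpermK k l.
  transitivity #|part (input_idx idx (c := d)) (p m)|.
    by rewrite partE cardsE; apply: eq_card => x; rewrite !inE (can2_eq pK pK).
  by rewrite -size_p partE cardsE.
have ue : u e = k by exact: val_inj.
have ue' : u e' = l by exact: val_inj.
(* s e lies in the block of e', so this correction keeps the blocks. *)
pose t := (perm (bij_inj bs) * tperm (s e) e')%g.
have tE (x : input G d) : u (t x) = p (u x).
  rewrite permM permE -sE; case: tpermP => [->|->|] //.
    by rewrite sE ue ue' tpermL.
  by rewrite sE ue ue' tpermL.
have te : t e = e' by rewrite permM permE tpermL.
have tp (m : 'I_(r d)) : (t @: part (input_idx idx (c := d)) m =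
             part (input_idx idx (c := d)) (p m))%SET.
  rewrite !partE (can_imset_pre _ (permK t)); apply/setP => x; rewrite !inE.
  by rewrite -{2}(permKV t x) tE (inj_eq perm_inj).
rewrite /partial; congr (derive1 _ _); apply/funext => h.
rewrite -[RHS](invA p pA t tp); congr (fh _ _); apply/funext => x /=.
have [<-|ex] := eqVneq e x; first by rewrite te !dfwithin.
rewrite !dfwithout //; apply: contraNneq ex => tx.
by apply/eqP; apply: (@perm_inj _ t); rewrite te.
Qed.
End Block.
End Network.

(** * Matching the inputs of a cell with those of its image *)

Section Match.
Variables (R : realType) (C : finType) (G : network C).
Variable fh : forall c : C, R -> (input G c -> R) -> R.
Variables (r : C -> nat) (idx : arrow G -> nat).
Variable J : forall c : C, {set {set 'I_(r c)}}.
Hypothesis indG : forall c, indexing fh (r c) (@input_idx C G idx c).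
Hypothesis JG : index_groups fh idx J.
Implicit Types c d : C.

Lemma group_of d (k : 'I_(r d)) :
  exists t : 'I_#|J d|, index_in (enum_val t : {set 'I_(r d)}) k.
Proof.
have [/and3P[/eqP cov _ _] _] := JG d.
have : k \in finset.cover (J d) by rewrite cov inE.
move=> /bigcupP[A AJ kA]; exists (enum_rank_in AJ A).
by apply/index_inP; exists k => //; rewrite enum_rankK_in.
Qed.

Lemma group_inhabited d (t : 'I_#|J d|) :
  exists e : input G d,
    index_in (enum_val t : {set 'I_(r d)}) (input_idx idx e).
Proof.
have [/and3P[_ _ J0] _] := JG d.
have [t0|[k kt]] := set_0Vmem (enum_val t : {set 'I_(r d)}).
  by move: (enum_valP t); rewrite t0 (negPf J0).
have [e ek] := index_surj (indG d) k.
by exists e; apply/index_inP; exists k.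
Qed.

(** The equality of sums is what differentiating two fillings [u] and [w] of
    the variables of [fh d] gives.  Genericity turns it into equal counts of
    variables with a given value and a given group, hence into a bijection
    preserving both. *)
Lemma match_inputs d (T : eqType) (u w : input G d -> T) :
  (forall (a : R) (x0 : T),
     \sum_(e | u e == x0) partial e (fh a) (fun=> a) =
     \sum_(e | w e == x0) partial e (fh a) (fun=> a)) ->
  generic fh idx J ->
  exists2 k : input G d -> input G d, bijective k &
    forall e, u (k e) = w e /\
      exists2 A, A \in J d &
        index_in A (input_idx idx e) /\ index_in A (input_idx idx (k e)).
Proof.
move=> eqFib gen.
have /boolp.choice[tau tauP] : forall e : input G d, exists t : 'I_#|J d|,
    index_in (enum_val t : {set 'I_(r d)}) (input_idx idx e).
  by move=> e; exact: (group_of (Ordinal (index_lt (indG d) e))).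
have /boolp.choice[y yP] := @group_inhabited d.
have [a detM] := gen d y yP.
have partial_tau s e : partial e (fh (a s)) (fun=> a s) =
    (\matrix_(s, t) partial (y t) (fh (a s)) (fun=> a s)) s (tau e).
  have symA : block_symmetric fh idx (enum_val (tau e) : {set 'I_(r d)}).
    exact: maximal_partition_good (JG d) (enum_valP (tau e)).
  by rewrite mxE (partial_block (indG d) symA _ _ (tauP e) (yP (tau e))).
have [x|k bk kE] := @eq_card_fibers_bij _ _ (T * 'I_#|J d|)%type
  (fun e => (w e, tau e)) (fun e => (u e, tau e)).
  case: x => x t; symmetry.
  have := eq_card_labels (P := fun e => u e == x) (Q := fun e => w e == x) detM.
  apply=> s.
  under eq_bigr do rewrite -partial_tau.
  by under [RHS]eq_bigr do rewrite -partial_tau.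
exists k => // e; have [-> te] := kE e; split=> //.
exists (enum_val (tau e)); first exact: enum_valP.
by split; [|rewrite -te]; exact: tauP.
Qed.
End Match.

(** The first variable receives [x c] on both sides, so its derivative, which
    occurs exactly when [x0 = c], cancels. *)
Lemma eq_sum_partial_inputs (R : realType) (C : finType) (G : network C)
    (fh : forall c : C, R -> (input G c -> R) -> R) (d c : C)
    (u w : input G d -> C) :
  smooth_gen fh d ->
  (forall x : C -> R, fh d (x c) (x \o u) = fh d (x c) (x \o w)) ->
  forall (a : R) (x0 : C),
    \sum_(e | u e == x0) partial e (fh d a) (fun=> a) =
    \sum_(e | w e == x0) partial e (fh d a) (fun=> a).
Proof.
move=> sm uw a x0.
pose F (z : option (input G d) -> R) := fh d (z None) (fun e => z (Some e)).
pose cell (g : input G d -> C) v := if v is Some e then g e else c.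
have /(_ a (fun v => cell u v == x0) (fun v => cell w v == x0)) :=
  eq_sum_partial sm.
have partialE e : partial (Some e) F (fun=> a) = partial e (fh d a) (fun=> a).
  rewrite /partial /F; congr (derive1 _ _); apply/funext => t.
  rewrite dfwithout //; congr (fh d _ _); apply/funext => e'.
  have [<-|ee'] := eqVneq e e'; first by rewrite !dfwithin.
  by rewrite !dfwithout.
rewrite !big_option /= => eqS.
under eq_bigr do rewrite -partialE.
under [RHS]eq_bigr do rewrite -partialE.
apply: (addrI (if c == x0 then partial None F (fun=> a) else 0)).
apply: eqS => t.
(* Only the coordinate x0 of the diagonal point moves. *)
exact: (uw (fun x => if x == x0 then t else a)).
Qed.

Lemma input_equiv_refl (R : realType) (C : finType) (G : network C)
    (fh : forall c : C, R -> (input G c -> R) -> R) (r : C -> nat)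
    (idx : arrow G -> nat) (c : C) :
  is_network_graph G -> step3 fh r idx -> input_equiv fh c c.
Proof.
move=> [eqC _ _] [ind _ _]; split; first exact: (eqC c c c).1.
exists (r c), (input_idx idx (c := c)), (input_idx idx (c := c)).
by split=> //; exact: same_function_refl.
Qed.

(** The two formulas for the component of [f] at [gamma d] fill the variables of
    [fh d] in two ways: through an index-preserving bijection [h] with the
    inputs of [gamma d], and through the arrows [b1] given by the relabelled
    graph, whose heads in [G] are [d].  Matching these fillings by [k] yields
    [kappa] as [h] after [k] after the inverse of [b1]. *)
Lemma match_moved_inputs (R : realType) (C : finType) (G : network C)
    (f : (C -> R) -> (C -> R))
    (fh : forall c : C, R -> (input G c -> R) -> R) (r : C -> nat)
    (idx : arrow G -> nat) (J : forall c : C, {set {set 'I_(r c)}})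
    (gamma : {perm C}) (d : C) :
  generating fh f -> step3 fh r idx -> index_groups fh idx J ->
  generic fh idx J -> relabel_admissible fh f gamma ->
  input_equiv fh d (gamma d) ->
  exists2 kappa : input G d -> input G (gamma d), injective kappa &
    forall e, arrow_tail (val (kappa e)) = gamma (arrow_tail (val e)) /\
      exists2 A, A \in J d & index_in A (input_idx idx e) /\
                             index_in A (input_idx idx (kappa e)).
Proof.
move=> [sm _ fE] [ind same arrE] JG gen adm equiv.
have [_ [card_parts fh_same]] := same _ _ equiv.
have [h bh hE] := eq_card_fibers_bij (fun k => etrans (esym (cardsE _))
  (etrans (card_parts k) (cardsE _))).
have [|b [bb bidx bE]] := adm d (gamma d); first by rewrite inE; apply/asboolP.
pose b0 (e : input G d) : arrow G := val (b e).
have b0d e : arrow_head (b0 e) == d.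
  by rewrite -(inj_eq (@perm_inj _ gamma)); exact: (valP (b e)).
pose b1 (e : input G d) : input G d := exist _ (b0 e) (b0d e).
have b1I : injective b1.
  by move=> e e' /(congr1 val) /= /val_inj; exact: (bij_inj bb).
have [g b1K gK] := injF_bij b1I.
have idx_b1 e : input_idx idx (b1 e) = input_idx idx e.
  by have /arrE[_ /esym] := bidx e.
have eqF := eq_sum_partial_inputs (u := fun e => arrow_tail (val (h e)))
  (w := fun e => gamma (arrow_tail (val (b1 e)))) (c := gamma d) (sm d).
have [|k bk kE] := match_inputs ind JG (d := d)
  (u := fun e => arrow_tail (val (h e)))
  (w := fun e => gamma (arrow_tail (val (b1 e)))) _ gen.
  by apply: eqF => x; rewrite -[RHS](bE x) fE -(fh_same h bh).
exists (fun e => h (k (g e))).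
  exact: inj_comp (bij_inj bh) (inj_comp (bij_inj bk) (can_inj gK)).
move=> e; have [-> [A AJ [Ae Ak]]] := kE (g e); rewrite gK; split=> //.
exists A => //; rewrite hE; split=> //.
by rewrite -(gK e) idx_b1.
Qed.

(** * Gluing the matchings *)

Section Glue.
Variables (C : finType) (G : network C) (gamma : {perm C}).
Variable kappa : forall c, input G c -> input G (gamma c).

Definition glue (e : arrow G) : arrow G :=
  val (kappa (exist _ e (eqxx (arrow_head e)) : input G (arrow_head e))).

Lemma glue_head e : arrow_head (glue e) = gamma (arrow_head e).
Proof. exact/eqP/(valP (kappa _)). Qed.

(** [glue] uses the matching indexed by the head of its argument; replacing that
    index by any cell provably equal to the head lets two arrows be compared
    under one [kappa c]. *)
Lemma glueE c (e : input G c) : glue (val e) = val (kappa e).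
Proof.
case: e => e ec /=; rewrite /glue; move: (ec); rewrite -(eqP ec) => ec'.
by congr (val (kappa _)); exact: val_inj.
Qed.

Lemma glue_inj : (forall c, injective (@kappa c)) -> injective glue.
Proof.
move=> kI e e' ee'.
have hd : arrow_head e' == arrow_head e.
  by apply/eqP/(@perm_inj _ gamma); rewrite -!glue_head ee'.
pose a : input G (arrow_head e) := exist _ e (eqxx _).
pose a' : input G (arrow_head e) := exist _ e' hd.
have : glue (val a) = glue (val a') by [].
by rewrite !glueE => /val_inj/kI/(congr1 val).
Qed.
End Glue.

Theorem proposition4p5 (R : realType) (n : nat)
    (f : ('I_n -> R) -> ('I_n -> R))
    (G : network 'I_n)
    (fh : forall c : 'I_n, R -> (input G c -> R) -> R)
    (r : 'I_n -> nat) (idx : arrow G -> nat)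
    (J : forall c : 'I_n, {set {set 'I_(r c)}})
    (gamma : {perm 'I_n}) :
  (forall c, smooth (fun x => f x c)) ->
  is_network_graph G ->
  generating fh f ->
  step3 fh r idx ->
  index_groups fh idx J ->
  generic fh idx J ->
  preserves_input_classes fh gamma ->
  relabel_admissible fh f gamma ->
  exists2 gamma' : {perm 'I_n} * {perm arrow G},
    gamma' \in graph_aut (coarsening fh idx J) & gamma = gamma'.1.
Proof.
move=> _ netG genf st JG gen pres adm.
have equiv d : input_equiv fh d (gamma d).
  suff : gamma d \in input_class fh d by rewrite inE => /asboolP.
  rewrite -(pres d); apply: imset_f; rewrite inE; apply/asboolP.
  exact: input_equiv_refl netG st.
pose good d (kappa : input G d -> input G (gamma d)) := injective kappa /\
  forall e, arrow_tail (val (kappa e)) = gamma (arrow_tail (val e)) /\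
      exists2 A, A \in J d & index_in A (input_idx idx e) /\
                             index_in A (input_idx idx (kappa e)).
have ex d : exists kappa, good d kappa.
  have [kappa kI kE] := match_moved_inputs genf st JG gen adm (equiv d).
  by exists kappa.
pose kappa d := sval (boolp.cid (ex d)).
have kI d : injective (kappa d) by case: (svalP (boolp.cid (ex d))).
have kE d e := (svalP (boolp.cid (ex d))).2 e.
pose s := perm (glue_inj kI).
exists (gamma, s) => //; rewrite inE /=; apply/and4P; split; apply/forallP => e.
- by rewrite permE glue_head.
- by rewrite permE; have [/eqP] := kE _ (exist _ e (eqxx (arrow_head e))).
- by have [] := equiv e.
- rewrite permE; apply/asboolP; rewrite /= glue_head; split; first exact: equiv.
  by have [_] := kE _ (exist _ e (eqxx (arrow_head e))).
Qed.
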